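(* Let $p$ be a prime with $p\equiv 1\pmod 3$, let $g$ be a fixed generator of $\mathbb{F}_p^{*}$, and let $y\in\mathbb{F}_p^{*}$ be an element that is not a cube in $\mathbb{F}_p$. Let $c$ and $d$ be the integers uniquely determined by $4p=c^2+27d^2$, $c\equiv 1\pmod 3$, $\gcd(c,p)=1$ and $d\ge 0$. Then $$T_3(y)=p^2+\frac{1}{2}(p-1)\left(-c-9\,\delta_y(p)\,d\right),$$ where $$\delta_y(p)=(-1)^{\langle \mathrm{ind}_g(y)\rangle_3}\cdot\mathrm{sgn}\left(\mathrm{Im}\left(r_1+3\sqrt{3}\,r_2\,\mathrm{i}\right)\right)$$ and $r_1,r_2$ are the integers uniquely determined by $$4p=r_1^2+27r_2^2,\qquad r_1\equiv 1\pmod 3,\qquad 9r_2\equiv\left(2g^{\frac{p-1}{3}}+1\right)r_1\pmod p.$$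
   Context: $\mathbb{F}_p$ is the field with $p$ elements and $\mathbb{F}_p^{*}=\mathbb{F}_p\setminus\{0\}$. $T_3(y)$ is the number of $(x_1,x_2,x_3)\in\mathbb{F}_p^3$ with $x_1^3+x_2^3+yx_3^3=0$. For $y\in\mathbb{F}_p^{*}$, the index $\mathrm{ind}_g(y)$ is the integer $e$ with $1\le e\le p-1$ and $y=g^e$. For an integer $n$, $\langle n\rangle_3$ is the unique $i\in\{0,1,2\}$ with $n\equiv i\pmod 3$. For real $x\neq 0$, $\mathrm{sgn}(x)=|x|/x$. Congruences modulo $p$ involving elements of $\mathbb{F}_p$ are read as equalities in $\mathbb{F}_p$. $\mathrm{i}=\sqrt{-1}$. *)

(* Defs.v *)
From HB Require Import structures.
From mathcomp Require Import all_boot all_order all_algebra all_fingroup.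
From mathcomp Require Import all_solvable all_field.
Set Implicit Arguments.
Unset Strict Implicit.
Unset Printing Implicit Defensive.
Import Order.TTheory GRing.Theory Num.Theory.
Local Open Scope ring_scope.

Definition T3 (p : nat) (y : 'F_p) : nat :=
  #|[set x : 'F_p * 'F_p * 'F_p |
      x.1.1 ^+ 3 + x.1.2 ^+ 3 + y * x.2 ^+ 3 == 0]|.

(* For p prime, g a generator and y != 0, exactly one e with 1 <= e <= p - 1
   satisfies y = g ^ e; the default 0 is only returned outside this case. *)
Definition ind (p : nat) (g : {unit 'F_p}) (y : 'F_p) : nat :=
  odflt 0%N (omap (@nat_of_ord p)
    [pick e : 'I_p | (0 < e)%N && (y == FinRing.uval g ^+ e)]).

(* Meant for real x != 0. *)
Definition sgn (x : algC) : algC := `|x| / x.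

Definition delta (p : nat) (g : {unit 'F_p}) (y : 'F_p) (r1 r2 : int) : algC :=
  (-1) ^+ (ind g y %% 3)%N *
  sgn ('Im (r1%:~R + 3 * sqrtC 3 * r2%:~R * 'i)).

Definition cd_spec (p : nat) (c d : int) : Prop :=
  [/\ 4 * p%:Z = c ^+ 2 + 27 * d ^+ 2,
      (c = 1 %[mod 3])%Z,
      gcdz c p%:Z = 1
    & 0 <= d].

Definition r_spec (p : nat) (g : {unit 'F_p}) (r1 r2 : int) : Prop :=
  [/\ 4 * p%:Z = r1 ^+ 2 + 27 * r2 ^+ 2,
      (r1 = 1 %[mod 3])%Z
    & 9 * r2%:~R = (2 * FinRing.uval g ^+ ((p - 1) %/ 3)%N + 1) * r1%:~R :> 'F_p].

(* Main.v *)
Require Import Defs.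
From HB Require Import structures.
From mathcomp Require Import all_boot all_order all_algebra all_fingroup.
From mathcomp Require Import all_solvable all_field.
From mathcomp Require Import ring zify.
Set Implicit Arguments.
Unset Strict Implicit.
Unset Printing Implicit Defensive.
Import Order.TTheory GRing.Theory Num.Theory.
Local Open Scope ring_scope.

(** Let chi be the cubic character of F_p sending g to a primitive cube root of
    unity z, and let J = sum_u chi(u) chi(1 - u) be its Jacobi sum.  The number
    of cube roots of a is 1 + chi(a) + chi^2(a), so T_3(y) is a sum of
    convolutions of 1, chi and chi^2; evaluating them gives
    T_3(y) = p^2 + (p - 1)(chi(y)^2 J + chi(y) J'), where J' is the Jacobi sum
    of the conjugate character chi^2 ([T3_jacobi]).

    It remains to identify J.
    - The usual double count gives J J' = p ([jacobi_norm]).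
    - For u other than 0 and 1, (chi(u) - 1)(chi(1 - u) - 1) is divisible by
      (z - 1)^2 = - 3 z.  Summing over u, J = 3 (s + t z) - p for integers s, t
      ([jacobi_int]).
    - The integers s and t depend neither on the ring that contains z nor on z
      itself, so that z may be taken in F_p: for z = omega = g^((p-1)/3) the
      character is x |-> x^((p-1)/3), J is a sum over F_p of a polynomial of
      degree less than p - 1, and therefore J = 0 ([jacobi_omega]).
    Hence r1 = 6 s - 2 p - 3 t and r2 = t satisfy 2 J = r1 + 3 r2 (2 z + 1):
    the norm of J gives 4 p = r1^2 + 27 r2^2, its shape gives r1 = 1 mod 3, and
    its vanishing for z = omega gives 9 r2 = (2 omega + 1) r1 in F_p
    ([jacobi_params]).  A representation of 4 p by c^2 + 27 d^2 with c = 1 mod 3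
    is unique up to the sign of d ([cubic_rep_unique]), so c = r1 and
    d = |r2|, and delta_y(p) d = (-1)^(ind y mod 3) r2 ([delta_norm]).  As y is
    not a cube, chi(y) is z or z^2, and the formula follows in either case. *)

(** * Primitive cube roots of unity *)

Section CubeRootsOfUnity.

Variables (R : idomainType) (z : R).

Lemma cube_root_quadratic : z ^+ 3 = 1 -> z != 1 -> z ^+ 2 + z + 1 = 0.
Proof.
move=> z3 z1; apply/eqP; have: (z - 1) * (z ^+ 2 + z + 1) = 0.
  by rewrite (_ : _ * _ = z ^+ 3 - 1); [rewrite z3 subrr | ring].
by move/eqP; rewrite mulf_eq0 subr_eq0 (negPf z1).
Qed.

Hypothesis hz : z ^+ 2 + z + 1 = 0.

Lemma root_sqE : z ^+ 2 = - z - 1.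
Proof. by apply/eqP; rewrite -subr_eq0; apply/eqP; rewrite -hz; ring. Qed.

Lemma root_cube : z ^+ 3 = 1.
Proof.
apply/eqP; rewrite -subr_eq0; apply/eqP.
by rewrite (_ : _ - _ = (z - 1) * (z ^+ 2 + z + 1)); [rewrite hz mulr0|ring].
Qed.

Lemma root_expr_mod3 i j : i = j %[mod 3] -> z ^+ i = z ^+ j.
Proof.
by move=> ij; rewrite -(expr_mod i root_cube) ij expr_mod // root_cube.
Qed.

(** The square of a root is the other root, so that results on z transfer to
    the conjugate. *)
Lemma root_sq_root : (z ^+ 2) ^+ 2 + z ^+ 2 + 1 = 0.
Proof.
rewrite (_ : _ + 1 = (z ^+ 2 + z + 1) * (z ^+ 2 - z + 1)); last by ring.
by rewrite hz mul0r.
Qed.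

Lemma root_neq1 : 3%:R != 0 :> R -> z != 1.
Proof. by apply: contraNneq => z1; rewrite -hz z1; apply/eqP; ring. Qed.

End CubeRootsOfUnity.

Lemma primitive_cube_root : exists z : algC, z ^+ 2 + z + 1 = 0.
Proof.
have [z hz] := @C_prim_root_exists 3 isT; exists z.
apply: cube_root_quadratic; first exact: prim_expr_order hz.
by rewrite -[z == 1]/(z ^+ 1 == z ^+ 0) (eq_prim_root_expr hz).
Qed.

Lemma eisenstein_norm (a b n : int) (z : algC) : z ^+ 2 + z + 1 = 0 ->
  (a%:~R + b%:~R * z) * (a%:~R + b%:~R * z ^+ 2) = n%:~R ->
  a ^+ 2 - a * b + b ^+ 2 = n.
Proof.
move=> hz N; apply: (@intr_inj algC).
rewrite -N !(rmorphD, rmorphN, rmorphM, rmorphXn) /=.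
by ring: (root_sqE hz).
Qed.

(** * Representations of 4p by c^2 + 27 d^2 *)

(** Two representations c^2 + 27 d^2 and c'^2 + 27 d'^2 of 4 p satisfy
    (c d' - c' d)(c d' + c' d) = 4 p (d'^2 - d^2), so p divides one of the two
    factors X; as Y^2 + 27 X^2 = 16 p^2 with Y = c c' + 27 d d' or
    c c' - 27 d d', this forces X = 0. *)
Lemma cubic_rep_unique (p : nat) (c d c' d' : int) : prime p ->
  4 * p%:Z = c ^+ 2 + 27 * d ^+ 2 -> 4 * p%:Z = c' ^+ 2 + 27 * d' ^+ 2 ->
  (c = 1 %[mod 3])%Z -> (c' = 1 %[mod 3])%Z -> c = c' /\ d ^+ 2 = d' ^+ 2.
Proof.
move=> hp E E' h h'; have p0 : 0 < p%:Z by have := prime_gt0 hp.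
suff hd : d ^+ 2 = d' ^+ 2.
  split=> //; have : (c - c') * (c + c') = 0.
    have -> : (c - c') * (c + c') =
        (4 * p%:Z - 27 * d ^+ 2) - (4 * p%:Z - 27 * d' ^+ 2).
      by rewrite {1}E E'; ring.
    by rewrite hd subrr.
  by move/eqP; rewrite mulf_eq0 => /orP[] /eqP; move: h h'; clear; lia.
have null X Y : Y ^+ 2 + 27 * X ^+ 2 = 16 * p%:Z ^+ 2 -> (p %| X)%Z -> X = 0.
  move=> H /dvdzP[k kX]; rewrite kX; have : 27 * k ^+ 2 <= 16.
    have : 27 * k ^+ 2 * p%:Z ^+ 2 <= 16 * p%:Z ^+ 2.
      by rewrite -H kX exprMn [in leRHS]mulrA lerDr sqr_ge0.
    by rewrite ler_pM2r // exprn_gt0.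
  move=> k2; suff -> : k = 0 by rewrite mul0r.
  apply/eqP; apply: contraTT k2 => k0; rewrite -ltNge.
  have : 0 < k ^+ 2 by rewrite exprn_even_gt0.
  by move: (k ^+ 2) => K; clear; lia.
have P2 : 16 * p%:Z ^+ 2 = (4 * p%:Z) * (4 * p%:Z) by ring.
have H : (c * d' - c' * d) * (c * d' + c' * d) = 4 * p%:Z * (d' ^+ 2 - d ^+ 2).
  by rewrite mulrBr {1}E {1}E'; ring.
suff : (c * d' - c' * d) * (c * d' + c' * d) = 0.
  rewrite H => /eqP; rewrite !mulf_eq0 subr_eq0 (gt_eqF p0) /= => /eqP //.
have : (p %| (c * d' - c' * d) * (c * d' + c' * d))%Z.
  by rewrite H -mulrA dvdz_mull // dvdz_mulr.
rewrite dvdzE abszM Euclid_dvdM // => /orP[] hX.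
  by rewrite (null _ (c * c' + 27 * d * d') _ hX) ?mul0r // P2 {1}E E'; ring.
by rewrite (null _ (c * c' - 27 * d * d') _ hX) ?mulr0 // P2 {1}E E'; ring.
Qed.

Lemma cubic_rep_coprime (p : nat) (c d : int) : prime p -> p = 1 %[mod 3] ->
  4 * p%:Z = c ^+ 2 + 27 * d ^+ 2 -> (c = 1 %[mod 3])%Z -> gcdz c p%:Z = 1.
Proof.
move=> hp hp3 E h; rewrite gcdzC /gcdz; congr Posz; apply/eqP.
rewrite -[_ == 1%N]/(coprime p `|c|) prime_coprime //; apply/negP => pc.
have /dvdzP[k kc] : (p%:Z %| c)%Z by [].
have p7 : (5 <= p)%N.
  have := prime_gt1 hp; have : p != 4 by apply: contraTneq hp => ->.
  by move: hp3; clear; lia.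
have k0 : k != 0 by apply: contraPneq h => k0; rewrite kc k0 mul0r.
have k1 : 1 <= k ^+ 2 by have : 0 < k ^+ 2 by [rewrite exprn_even_gt0].
have dd := sqr_ge0 d; have p0 : (0 <= p%:Z ^+ 2) := sqr_ge0 _.
have pk : p%:Z ^+ 2 <= k ^+ 2 * p%:Z ^+ 2 by rewrite ler_peMl.
have : p%:Z ^+ 2 <= 4 * p%:Z.
  by rewrite E kc exprMn (le_trans pk) // lerDl mulr_ge0.
by rewrite expr2 ler_pM2r; move: p7; clear; lia.
Qed.
Lemma cubic_rep_neq0 (p : nat) (c d : int) : prime p -> p = 1 %[mod 3] ->
  4 * p%:Z = c ^+ 2 + 27 * d ^+ 2 -> d != 0.
Proof.
move=> hp hp3 E; have p4 : ~~ (p %| 4)%N.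
  rewrite -[4%N]/(2 * 2)%N Euclid_dvdM // orbb dvdn_prime2 //.
  by apply/eqP => pE; move: hp3; rewrite {1}pE.
(* if d = 0 then p divides c, so p^2 divides c^2 = 4 p *)
apply: contraNneq p4 => d0; move: E.
rewrite d0 expr0n mulr0 addr0 => E.
have : (p %| c ^+ 2)%Z by rewrite -E dvdz_mull.
rewrite expr2 dvdzE abszM Euclid_dvdM // orbb => pc.
have /dvdzP[k kc] : (p%:Z %| c)%Z by [].
have p0 : p%:Z != 0 by have := prime_gt0 hp; lia.
have : (p%:Z %| 4)%Z.
  by apply/dvdzP; exists (k ^+ 2); apply: (mulIf p0); rewrite E kc; ring.
by [].
Qed.

Section CubicCharacter.

Variables (p : nat) (hp : prime p) (hp3 : p = 1 %[mod 3]).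
Variables (g : {unit 'F_p}) (hg : generator [set: {unit 'F_p}] g).

Local Notation gam := (FinRing.uval g).
Local Notation m := ((p - 1) %/ 3)%N.

(** * Powers of the generator and the index *)

Lemma pred_pE : (p - 1 = 3 * m)%N.
Proof. by have := prime_gt1 hp; move: hp3; lia. Qed.

Lemma m_gt0 : (0 < m)%N.
Proof. by have := prime_gt1 hp; have := pred_pE; lia. Qed.

Lemma order_g : #[g]%g = (p - 1)%N.
Proof.
move/eqP: hg => hg'.
by rewrite /order -hg' card_finField_unit card_Fp // subn1.
Qed.

Lemma gam_neq0 : gam != 0.
Proof. by rewrite -unitfE; exact: (valP g). Qed.

Lemma gamX_eq i j : (gam ^+ i == gam ^+ j) = (i == j %[mod p - 1]).
Proof.
by rewrite -order_g -eq_expg_mod_order -!FinRing.val_unitX (inj_eq val_inj).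
Qed.

Lemma indP (x : 'F_p) : x != 0 -> x = gam ^+ ind g x.
Proof.
move=> x0.
have ux : x \is a GRing.unit by rewrite unitfE.
have xg : FinRing.Unit ux \in <[g]>%g.
  by rewrite -(eqP (hg : _ == _)) inE.
have [i ilt xE] := cyclePmin xg.
have {}xE : x = gam ^+ i by rewrite -FinRing.val_unitX -xE.
rewrite order_g in ilt.
rewrite /ind; case: pickP => [e /andP[_ /eqP //]|none].
have hp1 := prime_gt1 hp.
have [i0|ipos] := posnP i.
  (* the index of 1 is p - 1, as indices range from 1 to p - 1 *)
  have lt : (p - 1 < p)%N by lia.
  have := none (Ordinal lt) => /=.
  have -> : (0 < p - 1)%N by lia.
  by rewrite xE gamX_eq i0 mod0n modnn eqxx.
have lt : (i < p)%N by lia.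
by have := none (Ordinal lt); rewrite /= ipos xE eqxx.
Qed.

Lemma gamX_mod3 i j : gam ^+ i = gam ^+ j -> i = j %[mod 3].
Proof.
move/eqP; rewrite gamX_eq pred_pE => /eqP h.
by rewrite -(modn_dvdm i (dvdn_mulr m (dvdnn 3))) h modn_dvdm // dvdn_mulr.
Qed.

Lemma ind_expg e : ind g (gam ^+ e) = e %[mod 3].
Proof. by apply: gamX_mod3; rewrite -indP // expf_neq0 // gam_neq0. Qed.

(** The primitive cube root of unity g^((p-1)/3) of F_p. *)
Definition omega : 'F_p := gam ^+ m.

Lemma omegaX3 : omega ^+ 3 = 1.
Proof.
rewrite /omega -exprM mulnC -pred_pE -[1](expr0 gam); apply/eqP.
by rewrite gamX_eq modnn mod0n.
Qed.

Lemma omega_neq1 : omega != 1.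
Proof.
rewrite /omega -[1](expr0 gam) gamX_eq.
have := m_gt0; have := pred_pE => pE m0.
by rewrite mod0n modn_small; lia.
Qed.

Lemma omega_root : omega ^+ 2 + omega + 1 = 0.
Proof. exact: cube_root_quadratic omegaX3 omega_neq1. Qed.

Lemma intFp_eq0 (n : int) : (n%:~R == 0 :> 'F_p) = (p%:Z %| n)%Z.
Proof.
rewrite dvdzE /= (dvdn_pcharf (pchar_Fp hp)).
case: n => n; first by [].
by rewrite NegzE mulrNz oppr_eq0 abszN.
Qed.

Lemma three_neq0_Fp : 3%:R != 0 :> 'F_p.
Proof.
rewrite -(dvdn_pcharf (pchar_Fp hp)).
apply/negP => /dvdn_leq - /(_ isT) h.
have := prime_gt1 hp; move: hp3 h; lia.
Qed.

(** * The cubic character *)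

(** For a root z of X^2 + X + 1 in an integral domain R, the cubic character of
    F_p with values in R that sends g to z, extended by 0 at 0.  The conjugate
    character is chi (z ^+ 2).  Both R = algC and R = F_p are needed. *)
Definition chi (R : idomainType) (z : R) (x : 'F_p) : R :=
  if x == 0 then 0 else z ^+ ind g x.

Section Jacobi.

Variables (R : idomainType).
Implicit Types z : R.
Hypothesis h3 : 3%:R != 0 :> R.

Lemma chi0 z : chi z 0 = 0. Proof. by rewrite /chi eqxx. Qed.

Lemma chi_expg z e : z ^+ 2 + z + 1 = 0 -> chi z (gam ^+ e) = z ^+ e.
Proof.
move=> hz; rewrite /chi expf_eq0 (negPf gam_neq0) andbF.
by apply: root_expr_mod3 => //; exact: ind_expg.
Qed.

Lemma chi1 z : z ^+ 2 + z + 1 = 0 -> chi z 1 = 1.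
Proof. by move=> hz; rewrite -[1](expr0 gam) chi_expg. Qed.

Lemma chiM z x y : z ^+ 2 + z + 1 = 0 -> chi z (x * y) = chi z x * chi z y.
Proof.
move=> hz; have [->|x0] := eqVneq x 0; first by rewrite mul0r chi0 mul0r.
have [->|y0] := eqVneq y 0; first by rewrite mulr0 chi0 mulr0.
by rewrite (indP x0) (indP y0) -exprD !chi_expg // exprD.
Qed.

Lemma chiX3 z x : z ^+ 2 + z + 1 = 0 -> x != 0 -> chi z x ^+ 3 = 1.
Proof.
by move=> hz x0; rewrite /chi (negPf x0) -exprM mulnC exprM root_cube // expr1n.
Qed.

Lemma chi_cube z x : z ^+ 2 + z + 1 = 0 -> x != 0 -> chi z (x ^+ 3) = 1.
Proof.
move=> hz x0; rewrite !exprS !chiM // expr0 chi1 // -[RHS](chiX3 hz x0).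
by ring.
Qed.

Lemma chiN z x : z ^+ 2 + z + 1 = 0 -> chi z (- x) = chi z x.
Proof.
move=> hz; rewrite (_ : - x = (-1) ^+ 3 * x); last by ring.
by rewrite chiM // chi_cube ?mul1r // oppr_eq0 oner_neq0.
Qed.

Lemma chi_sqz z x : chi (z ^+ 2) x = chi z x ^+ 2.
Proof. by rewrite /chi; case: ifP => _; rewrite ?expr0n // -!exprM mulnC. Qed.

Lemma sum_chi z : z ^+ 2 + z + 1 = 0 -> \sum_x chi z x = 0.
Proof.
move=> hz; apply/eqP; have: (z - 1) * \sum_x chi z x = 0.
  rewrite mulrBl mul1r mulr_sumr.
  rewrite [X in _ - X](reindex_inj (mulfI gam_neq0)) /=.
  apply/eqP; rewrite subr_eq0; apply/eqP; apply: eq_bigr => x _.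
  by rewrite chiM // -[in chi z gam](expr1 gam) chi_expg.
by move/eqP; rewrite mulf_eq0 subr_eq0 (negPf (root_neq1 hz h3)).
Qed.

(** * Convolutions of characters and the norm of the Jacobi sum *)

(** The Jacobi sum J(chi, chi) of chi = chi z. *)
Definition jacobi z : R := \sum_x chi z x * chi z (1 - x).

Lemma conv_chi z t : z ^+ 2 + z + 1 = 0 ->
  \sum_x chi z x * chi z (t - x) =
    if t == 0 then 0 else chi z t ^+ 2 * jacobi z.
Proof.
move=> hz; case: eqVneq => [->|t0].
  rewrite -[RHS](sum_chi (root_sq_root hz)); apply: eq_bigr => x _.
  by rewrite sub0r chiN // chi_sqz expr2.
rewrite (reindex_inj (mulfI t0)) /= mulr_sumr; apply: eq_bigr => x _.
by rewrite (_ : t - t * x = t * (1 - x)) ?chiM //; ring.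
Qed.

Lemma card_neq0 : \sum_(x : 'F_p | x != 0) 1 = p%:R - 1 :> R.
Proof.
have <-: \sum_(x : 'F_p) 1 = p%:R :> R by rewrite sumr_const card_Fp.
by rewrite [in RHS](bigD1 0) //= addrAC subrr add0r.
Qed.

Lemma sum_chi_sq z : z ^+ 2 + z + 1 = 0 ->
  \sum_x chi z x * chi (z ^+ 2) x = p%:R - 1.
Proof.
move=> hz; rewrite -card_neq0 [LHS](bigD1 0) //= chi0 mul0r add0r.
by apply: eq_bigr => x x0; rewrite chi_sqz -exprS chiX3.
Qed.

Lemma conv_chi_chibar z t : z ^+ 2 + z + 1 = 0 ->
  \sum_x chi z x * chi (z ^+ 2) (t - x) = (if t == 0 then p%:R else 0) - 1.
Proof.
move=> hz; have hz2 := root_sq_root hz.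
case: eqVneq => [->|t0].
  by rewrite -[RHS](sum_chi_sq hz); apply: eq_bigr => x _; rewrite sub0r chiN.
rewrite (bigD1 0) //= chi0 mul0r add0r.
(* with x = t / v, chi(x) chi^2(t - x) = chi(x)^3 chi^2(v - 1) = chi^2(v - 1) *)
rewrite (reindex_onto (fun v => t * v^-1) (fun x => t * x^-1)) /=; last first.
  by move=> x x0; rewrite invfM invrK mulrA divff // mul1r.
rewrite (eq_bigl (fun v => v != 0)) => [|v]; last first.
  have [->|v0] := eqVneq v 0; first by rewrite invr0 mulr0 eqxx.
  by rewrite mulf_neq0 ?invr_neq0 //= invfM invrK mulrA divff // mul1r eqxx.
transitivity (\sum_(v | v != 0) chi (z ^+ 2) (v - 1)).
  apply: eq_bigr => v v0.
  rewrite (_ : t - t * v^-1 = t * v^-1 * (v - 1)); last first.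
    by rewrite mulrBr mulr1 mulfVK.
  rewrite [chi (z ^+ 2) (t * v^-1 * _)]chiM // mulrA [X in X * _]mulrC.
  rewrite chi_sqz -exprSr.
  by rewrite chiX3 ?mul1r // mulf_neq0 // invr_neq0.
apply/eqP; rewrite sub0r eq_sym -subr_eq0 -opprD oppr_eq0; apply/eqP.
rewrite -[RHS](sum_chi hz2) [RHS](reindex_inj (addIr (-1))) /=.
by rewrite [RHS](bigD1 0) //= sub0r chiN // chi1.
Qed.

(** Both sides are compared after multiplication by p - 1, by evaluating in two
    ways the sum of chi(a) chi(b) chi^2(c) chi^2(d) over a + b = c + d: by the
    value t of a + b, where the term t = 0 vanishes, and by the value of
    c - a = b - d. *)
Lemma jacobi_norm z : z ^+ 2 + z + 1 = 0 -> p%:R - 1 != 0 :> R ->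
  jacobi z * jacobi (z ^+ 2) = p%:R.
Proof.
move=> hz p1; have hz2 := root_sq_root hz; apply: (mulfI p1).
pose c1 t := \sum_x chi z x * chi z (t - x).
pose c2 t := \sum_x chi (z ^+ 2) x * chi (z ^+ 2) (t - x).
transitivity (\sum_t c1 t * c2 t).
  rewrite (bigD1 0) //= /c1 conv_chi // eqxx mul0r add0r -card_neq0 mulr_suml.
  apply: eq_bigr => t t0; rewrite mul1r /c2 !conv_chi // (negPf t0).
  by rewrite mulrACA chi_sqz -!exprMn -exprS chiX3 // expr1n mul1r.
transitivity (\sum_a \sum_c chi z a * chi (z ^+ 2) c *
                (\sum_t chi z (t - a) * chi (z ^+ 2) (t - c))).
  under eq_bigr => t _ do rewrite /c1 /c2 mulr_suml.
  rewrite exchange_big; apply: eq_bigr => a _.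
  under eq_bigr => t _ do rewrite mulr_sumr.
  rewrite exchange_big; apply: eq_bigr => c _.
  by rewrite mulr_sumr; apply: eq_bigr => t _; rewrite mulrACA.
rewrite -(sum_chi_sq hz) mulr_suml; apply: eq_bigr => a _.
transitivity (\sum_c chi z a *
    (chi (z ^+ 2) c * ((if c - a == 0 then p%:R else 0) - 1))).
  apply: eq_bigr => c _; rewrite -mulrA -(conv_chi_chibar _ hz).
  congr (_ * (_ * _)); rewrite (reindex_inj (addIr a)) /=.
  apply: eq_bigr => t _; rewrite addrK -[chi _ (c - a - t)]chiN //.
  by congr (_ * chi _ _); ring.
rewrite -mulr_sumr -mulrA; congr (_ * _).
under eq_bigr => c _ do rewrite mulrBr mulr1.
rewrite sumrB sum_chi // subr0 (bigD1 a) //= subrr eqxx big1 ?addr0 //.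
by move=> c ca; rewrite subr_eq0 (negPf ca) mulr0.
Qed.

End Jacobi.

Lemma sum_pred1 (R : idomainType) (F : 'F_p -> R) a :
  \sum_x F x * (x == a)%:R = F a.
Proof.
by rewrite (bigD1 a) //= eqxx mulr1 big1 ?addr0 // => x /negPf ->; rewrite mulr0.
Qed.

(** * Integrality of the Jacobi sum *)

(** The same integers s and t serve for every integral domain R in which 3 is
    nonzero, and for every root z in R. *)
Lemma jacobi_int : exists s t : int, forall (R : idomainType) (z : R),
  3%:R != 0 :> R -> z ^+ 2 + z + 1 = 0 ->
  jacobi z = 3 * (s%:~R + t%:~R * z) - p%:R.
Proof.
have loc (u : 'F_p) : exists st : int * int, forall (R : idomainType) (z : R),
    z ^+ 2 + z + 1 = 0 ->
    (chi z u - (u != 0)%:R) * (chi z (1 - u) - (1 - u != 0)%:R)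
      = 3 * (st.1%:~R + st.2%:~R * z).
  have [->|u0] := eqVneq u 0.
    by exists (0, 0) => R z hz; rewrite chi0 /= subrr; ring.
  have [->|u1] := eqVneq (1 - u) 0.
    by exists (0, 0) => R z hz; rewrite chi0 /= subrr; ring.
  rewrite /chi (negPf u0) (negPf u1) /=.
  move: (ind g u) (ind g (1 - u)) => i j.
  have red k (R : idomainType) (z : R) :
      z ^+ 2 + z + 1 = 0 -> z ^+ k = z ^+ (k %% 3).
    by move=> hz; apply: root_expr_mod3; rewrite ?modn_mod.
  have hi : (i %% 3 < 3)%N by rewrite ltn_mod.
  have hj : (j %% 3 < 3)%N by rewrite ltn_mod.
  (* (z - 1)^2 = - 3 z, (z - 1)(z^2 - 1) = 3 and (z^2 - 1)^2 = 3 (1 + z) *)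
  pose f (a b : nat) : int * int := match a, b with
    | 1%N, 1%N => (0, -1)
    | 1%N, 2%N | 2%N, 1%N => (1, 0)
    | 2%N, 2%N => (1, 1)
    | _, _ => (0, 0)
    end.
  exists (f (i %% 3) (j %% 3))%N => R z hz; rewrite (red i) // (red j) //.
  case: (i %% 3)%N hi => [|[|[|//]]] _; case: (j %% 3)%N hj => [|[|[|//]]] _ /=;
    rewrite ?expr0 ?expr1; ring: (root_sqE hz).
have [st hst] := fin_all_exists loc.
exists (\sum_u (st u).1), (\sum_u (st u).2) => R z h3 hz.
rewrite !rmorph_sum /= mulr_suml -big_split mulr_sumr /=.
transitivity (\sum_u (chi z u - 1 + (u == 0)%:R) *
    (chi z (1 - u) - 1 + (u == 1)%:R) - p%:R); last first.
  congr (_ - _); apply: eq_bigr => u _; rewrite -hst // subr_eq0 [1 == u]eq_sym.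
  by case: eqVneq => _; case: eqVneq => _; rewrite /=; ring.
have e1 : \sum_(u : 'F_p) chi z (1 - u) = 0.
  by rewrite -[RHS](sum_chi h3 hz) [RHS](reindex_inj (inv_inj (subKr 1))).
have ep : \sum_(u : 'F_p) 1 = p%:R :> R by rewrite sumr_const card_Fp.
transitivity (jacobi z - \sum_u chi z u - \sum_u chi z (1 - u)
    + \sum_(u : 'F_p) 1 + \sum_u (chi z u - 1) * (u == 1)%:R
    + \sum_u (chi z (1 - u) - 1 + (u == 1)%:R) * (u == 0)%:R - p%:R).
  rewrite !sum_pred1 ep e1 sum_chi // (subr0 1) chi1 // eq_sym oner_eq0 /=.
  by ring.
congr (_ - _); rewrite /jacobi -!sumrB -!big_split /=.
by apply: eq_bigr => u _; ring.
Qed.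

(** * The Jacobi sum in F_p *)

Lemma chi_omega x : chi omega x = x ^+ m.
Proof.
have [->|x0] := eqVneq x 0; first by rewrite chi0 expr0n -leqn0 leqNgt m_gt0.
by rewrite /chi (negPf x0) {2}(indP x0) /omega -!exprM mulnC.
Qed.

Lemma power_sum k : (k < p - 1)%N -> \sum_(x : 'F_p) x ^+ k = 0.
Proof.
have [->|k0] := posnP k => lt.
  under eq_bigr => x _ do rewrite expr0.
  by rewrite sumr_const card_Fp // pchar_Fp_0.
apply/eqP; have: (gam ^+ k - 1) * \sum_(x : 'F_p) x ^+ k = 0.
  rewrite mulrBl mul1r mulr_sumr.
  rewrite [X in _ - X](reindex_inj (mulfI gam_neq0)) /=.
  apply/eqP; rewrite subr_eq0; apply/eqP; apply: eq_bigr => x _.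
  by rewrite exprMn.
move/eqP; rewrite mulf_eq0 subr_eq0 -[X in _ == X](expr0 gam) gamX_eq.
by rewrite mod0n modn_small // -leqn0 leqNgt k0.
Qed.

Lemma sum_horner (P : {poly 'F_p}) : (size P <= p - 1)%N -> \sum_x P.[x] = 0.
Proof.
move=> sP; under eq_bigr => x _ do rewrite horner_coef.
rewrite exchange_big big1 // => i _.
by rewrite -mulr_sumr power_sum ?mulr0 // (leq_trans (ltn_ord i)).
Qed.

Lemma jacobi_omega : jacobi omega = 0.
Proof.
rewrite -(sum_horner (P := 'X ^+ m * (1 - 'X) ^+ m)).
  by apply: eq_bigr => x _; rewrite !chi_omega !hornerE.
apply: (leq_trans (size_polyMleq _ _)).
have h1 : size ('X ^+ m : {poly 'F_p}) = m.+1 by rewrite size_polyXn.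
have h2 : (size ((1 - 'X) ^+ m : {poly 'F_p}) <= m.+1)%N.
  apply: (leq_trans (size_poly_exp_leq _ _)).
  by rewrite -opprB size_polyN -[1]/(1%:P) size_XsubC mul1n.
have := m_gt0; have := pred_pE; rewrite h1; lia.
Qed.

(** * The integers r1 and r2 *)

Lemma jacobi_params : exists r : int * int, r_spec g r.1 r.2 /\
  forall z : algC, z ^+ 2 + z + 1 = 0 ->
    2 * jacobi z = r.1%:~R + 3 * r.2%:~R * (2 * z + 1).
Proof.
have [s [t jst]] := jacobi_int.
pose a := 3 * s - p%:Z; pose b := 3 * t.
have jE (z : algC) : z ^+ 2 + z + 1 = 0 -> jacobi z = a%:~R + b%:~R * z.
  by move=> hz; rewrite jst ?pnatr_eq0 // /a /b rmorphB !rmorphM /=; ring.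
exists (2 * a - b, t); split=> [|z hz]; last first.
  by rewrite jE //= /a /b !(rmorphB, rmorphM) /=; ring.
split=> /=.
- have [z hz] := primitive_cube_root.
  have p1 : p%:R - 1 != 0 :> algC.
    by rewrite subr_eq0 pnatr_eq1; have := prime_gt1 hp; lia.
  have := jacobi_norm (_ : 3%:R != 0) hz p1; rewrite pnatr_eq0 => /(_ isT).
  rewrite !jE ?root_sq_root // => N.
  by rewrite -(eisenstein_norm (n := p%:Z) hz N) /b; ring.
- by rewrite /a /b; move: hp3; clear; lia.
have := jst _ omega three_neq0_Fp omega_root.
rewrite jacobi_omega pchar_Fp_0 // subr0 => /esym/eqP.
rewrite mulf_eq0 (negPf three_neq0_Fp) /= => /eqP st0.
have sE : s%:~R = - (t%:~R * omega) by apply/eqP; rewrite -addr_eq0; apply/eqP.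
rewrite -/omega /a /b !(rmorphB, rmorphM) /= -pmulrn pchar_Fp_0 // sE.
by ring: (root_sqE omega_root).
Qed.

(** The congruence modulo p fixes the sign of r2: otherwise p divides 18 r2,
    hence r2, which is too large unless r2 = 0. *)
Lemma r_spec_unique r1 r2 r1' r2' :
  r_spec g r1 r2 -> r_spec g r1' r2' -> r1 = r1' /\ r2 = r2'.
Proof.
move=> [E h F] [E' h' F'].
have [r12 sq] := cubic_rep_unique hp E E' h h'; split=> //.
move/eqP: sq; rewrite -subr_eq0 subr_sqr mulf_eq0 subr_eq0 => /orP[/eqP //|/eqP opp].
have r2E : r2' = - r2 by apply/eqP; rewrite -addr_eq0 addrC opp.
rewrite -r12 -F r2E in F'.
have pd : (p%:Z %| 3 * (3 * (2 * r2)))%Z.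
  rewrite -intFp_eq0; apply/eqP.
  have -> : (3 * (3 * (2 * r2)))%:~R = 9 * r2%:~R - 9 * (- r2)%:~R :> 'F_p.
    by rewrite !rmorphM rmorphN /=; ring.
  by rewrite F' subrr.
have pgt := prime_gt1 hp.
have p2 : (p %| 2)%N = false.
  by rewrite dvdn_prime2 //; apply/eqP => pE; move: hp3; rewrite {1}pE.
have p3 : (p %| 3)%N = false.
  by rewrite dvdn_prime2 //; apply/eqP => pE; move: hp3; rewrite {1}pE.
have pr : (p%:Z %| r2)%Z.
  by move: pd; rewrite !dvdzE !abszM !Euclid_dvdM //= p2 p3.
case/dvdzP: pr => k kr; rewrite kr in E.
have : k ^+ 2 <= 0.
  have : 27 * p%:Z * (p%:Z * k ^+ 2) <= 4 * p%:Z.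
    by rewrite E (_ : _ * _ = 27 * (k * p) ^+ 2); [rewrite lerDr sqr_ge0|ring].
  by move: (k ^+ 2) (sqr_ge0 k) => K; move: pgt; clear; nia.
rewrite real_exprn_even_le0 ?num_real //= => /eqP k0.
by rewrite r2E kr k0 mul0r oppr0.
Qed.

(** * Counting points on the cubic *)

Section Counting.

Variable z : algC.
Hypothesis hz : z ^+ 2 + z + 1 = 0.

Let h3 : 3%:R != 0 :> algC. Proof. by rewrite pnatr_eq0. Qed.

(** The number of cube roots of a, in terms of characters. *)
Let ncube (a : 'F_p) : algC := 1 + chi z a + chi (z ^+ 2) a.

Lemma card_cube_roots a : \sum_(x : 'F_p) (x ^+ 3 == a)%:R = ncube a.
Proof.
rewrite /ncube chi_sqz.
have [->|a0] := eqVneq a 0.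
  rewrite chi0 expr0n /= !addr0 -[RHS](sum_pred1 (fun=> 1) 0).
  by apply: eq_bigr => x _; rewrite expf_eq0 /= mul1r.
have [e3|e3] := eqVneq (ind g a %% 3)%N 0%N.
  have aE : a = (gam ^+ (ind g a %/ 3)) ^+ 3.
    by rewrite {1}(indP a0) {1}(divn_eq (ind g a) 3) e3 addn0 exprM.
  set b := gam ^+ _ in aE.
  have b0 : b != 0 by rewrite expf_neq0 // gam_neq0.
  have w2 : omega ^+ 2 != 1.
    apply: contraNneq omega_neq1 => w2; apply/eqP.
    by rewrite -[LHS]mul1r -w2 -exprSr omegaX3.
  transitivity (\sum_x ((x == b)%:R + (x == b * omega)%:R +
      (x == b * omega ^+ 2)%:R) : algC).
    apply: eq_bigr => x _; rewrite aE -subr_eq0.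
    have -> : x ^+ 3 - b ^+ 3 = (x - b) * (x - b * omega) * (x - b * omega ^+ 2).
      by ring: (root_sqE omega_root).
    rewrite !mulf_eq0 !subr_eq0.
    have bw : (b == b * omega) = false.
      by rewrite -{1}[b]mulr1 (inj_eq (mulfI b0)) eq_sym (negPf omega_neq1).
    have bw2 : (b == b * omega ^+ 2) = false.
      by rewrite -{1}[b]mulr1 (inj_eq (mulfI b0)) eq_sym (negPf w2).
    have bww : (b * omega == b * omega ^+ 2) = false.
      have bw0 : b * omega != 0 by rewrite mulf_neq0 // expf_neq0 // gam_neq0.
      rewrite expr2 mulrA -{1}[b * omega]mulr1 (inj_eq (mulfI bw0)) eq_sym.
      exact: negPf omega_neq1.
    have [->|_] := eqVneq x b; first by rewrite bw bw2 /= !addr0.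
    have [->|_] := eqVneq x (b * omega); first by rewrite bww /= add0r addr0.
    by rewrite /= !add0r.
  have one c : \sum_(x : 'F_p) (x == c)%:R = 1 :> algC.
    rewrite -[RHS](sum_pred1 (fun=> 1 : algC) c).
    by apply: eq_bigr => x _; rewrite mul1r.
  by rewrite !big_split /= !one aE chi_cube // expr1n.
rewrite big1 => [|x _].
  rewrite (indP a0) chi_expg // (root_expr_mod3 hz (esym (modn_mod _ _))).
  have : (ind g a %% 3 < 3)%N by rewrite ltn_mod.
  case: (ind g a %% 3)%N e3 => [|[|[|//]]] // _ _.
    by rewrite expr1 -[LHS]hz; ring.
  by rewrite -[LHS](root_sq_root hz); ring.
case: eqP => // xa; case/negP: e3.
have x0 : x != 0 by apply: contraNneq a0 => x0; rewrite -xa x0 expr0n.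
by rewrite -xa {1}(indP x0) -exprM ind_expg modnMl.
Qed.

Lemma sum_cubes (F : 'F_p -> algC) : \sum_x F (x ^+ 3) = \sum_a ncube a * F a.
Proof.
under [RHS]eq_bigr => a _ do rewrite -card_cube_roots mulr_suml.
rewrite exchange_big; apply: eq_bigr => x _ /=.
by rewrite -[LHS](sum_pred1 F); apply: eq_bigr => a _; rewrite mulrC eq_sym.
Qed.

(** The number of solutions of x1^3 + x2^3 = t. *)
Lemma conv_ncube t : \sum_a ncube a * ncube (t - a) =
  if t == 0 then 3 * p%:R - 2 else
    p%:R - 2 + chi z t ^+ 2 * jacobi z + chi z t * jacobi (z ^+ 2).
Proof.
have hz2 := root_sq_root hz.
have z4 : (z ^+ 2) ^+ 2 = z by rewrite -exprM exprS (root_cube hz) mulr1.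
have flip (z' : algC) : z' ^+ 2 + z' + 1 = 0 ->
    \sum_(a : 'F_p) chi z' (t - a) = 0.
  move=> hz'; rewrite -[RHS](sum_chi h3 hz').
  by rewrite [RHS](reindex_inj (inv_inj (subKr t))).
transitivity (\sum_(a : 'F_p) 1 + \sum_a chi z a + \sum_a chi (z ^+ 2) a
   + \sum_a chi z (t - a) + \sum_a chi (z ^+ 2) (t - a)
   + \sum_a chi z a * chi z (t - a) + \sum_a chi (z ^+ 2) a * chi (z ^+ 2) (t - a)
   + \sum_a chi z a * chi (z ^+ 2) (t - a)
   + \sum_a chi (z ^+ 2) a * chi ((z ^+ 2) ^+ 2) (t - a)).
  by rewrite z4 -!big_split /=; apply: eq_bigr => a _; rewrite /ncube; ring.
rewrite !flip // !sum_chi // !conv_chi_chibar // !conv_chi //.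
rewrite sumr_const card_Fp //; case: eqVneq => [_|t0]; first by ring.
have -> : chi (z ^+ 2) t ^+ 2 = chi z t.
  by rewrite chi_sqz -exprM exprS chiX3 // mulr1.
by ring.
Qed.

Lemma T3_jacobi y : y != 0 -> (T3 y)%:R =
  p%:R ^+ 2 + (p%:R - 1) *
    (chi z y ^+ 2 * jacobi z + chi z y * jacobi (z ^+ 2)) :> algC.
Proof.
move=> y0.
have -> : (T3 y)%:R =
    \sum_c \sum_b \sum_a (a ^+ 3 + b ^+ 3 + y * c ^+ 3 == 0)%:R :> algC.
  rewrite /T3 -sum1_card natr_sum big_mkcond /=.
  transitivity (\sum_(x : 'F_p * 'F_p * 'F_p)
     (x.1.1 ^+ 3 + x.1.2 ^+ 3 + y * x.2 ^+ 3 == 0)%:R : algC).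
    by apply: eq_bigr => x _; rewrite inE; case: (_ == 0).
  rewrite -(pair_bigA _
    (fun q c => (q.1 ^+ 3 + q.2 ^+ 3 + y * c ^+ 3 == 0)%:R)) /=.
  rewrite exchange_big; apply: eq_bigr => c _ /=.
  rewrite -(pair_bigA _ (fun a b => (a ^+ 3 + b ^+ 3 + y * c ^+ 3 == 0)%:R)) /=.
  exact: exchange_big.
transitivity (\sum_(c : 'F_p) \sum_b ncube b * ncube (- (y * c ^+ 3) - b)).
  apply: eq_bigr => c _; rewrite -(sum_cubes (fun b => ncube (- (y * c ^+ 3) - b))).
  apply: eq_bigr => b _; rewrite -card_cube_roots; apply: eq_bigr => a _.
  by rewrite -[in LHS]addrA addr_eq0 opprD addrC [- _ - _]addrC.
rewrite (bigD1 0) //= conv_ncube expr0n mulr0 oppr0 eqxx.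
(* for c != 0 the inner sum does not depend on c, as - c^3 is a cube *)
set S := chi z y ^+ 2 * _ + _.
rewrite (eq_bigr (fun c : 'F_p => 1 * (p%:R - 2 + S))) => [|c c0].
  by rewrite -mulr_suml card_neq0; ring.
rewrite conv_ncube oppr_eq0 mulf_eq0 expf_eq0 (negPf y0) (negPf c0) /=.
by rewrite chiN // chiM // chi_cube // mulr1 mul1r /S addrA.
Qed.

End Counting.

End CubicCharacter.

(** * The sign and the point count *)

Lemma delta_norm (p : nat) (g : {unit 'F_p}) (y : 'F_p) (r1 r2 d : int) :
  r2 != 0 -> 0 <= d -> d ^+ 2 = r2 ^+ 2 ->
  delta g y r1 r2 * d%:~R = (-1) ^+ (ind g y %% 3)%N * r2%:~R.
Proof.
move=> r0 d0 sq.
have dE : d = `|r2|.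
  by apply/eqP; rewrite -(@eqrXn2 _ 2) ?normr_ge0 // real_normK ?num_real // sq.
have k0 : 0 < 3 * sqrtC 3 :> algC by rewrite mulr_gt0 ?sqrtC_gt0 ?ltr0n.
have r0' : r2%:~R != 0 :> algC by rewrite intr_eq0.
rewrite /delta -[LHS]mulrA; congr (_ * _).
rewrite [3 * _ * _ * _]mulrC Im_rect ?(realM (gtr0_real k0)) ?realz //.
rewrite /sgn normrM (gtr0_norm k0) dE intr_norm.
have N2 : `|r2%:~R| ^+ 2 = r2%:~R ^+ 2 :> algC by rewrite real_normK ?realz.
apply: (mulIf r0'); rewrite -[RHS]expr2 -N2.
by field; rewrite r0' sqrtC_eq0 pnatr_eq0.
Qed.

Theorem theorem1p6 (p : nat) (hp : prime p) (hp3 : p = 1 %[mod 3])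
    (g : {unit 'F_p}) (hg : generator [set: {unit 'F_p}] g)
    (y : 'F_p) (hy0 : y != 0) (hy : ~ exists x : 'F_p, y = x ^+ 3) :
  [/\ exists! cd : int * int, cd_spec p cd.1 cd.2,
      exists! r : int * int, r_spec g r.1 r.2
    & forall c d r1 r2 : int, cd_spec p c d -> r_spec g r1 r2 ->
        (T3 y)%:R = p%:R ^+ 2 +
          2^-1 * (p%:R - 1) * (- c%:~R - 9 * delta g y r1 r2 * d%:~R) :> algC].
Proof.
have [[r1 r2] [rs jac]] := jacobi_params hp hp3 hg.
rewrite /= in rs jac; have [E h F] := rs.
have cds : cd_spec p r1 `|r2|.
  split=> //; first by rewrite real_normK ?num_real.
  exact: cubic_rep_coprime hp hp3 E h.
have cdu c d : cd_spec p c d -> c = r1 /\ d = `|r2|.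
  case=> E' h' _ d0; have [-> sq] := cubic_rep_unique hp E' E h' h; split=> //.
  by apply/eqP; rewrite -(@eqrXn2 _ 2) ?normr_ge0 // real_normK ?num_real // sq.
have ru r1' r2' : r_spec g r1' r2' -> r1 = r1' /\ r2 = r2'.
  exact: r_spec_unique rs.
split.
- by exists (r1, `|r2|); split=> // -[c d] /cdu /= [-> ->].
- by exists (r1, r2); split=> // -[r1' r2'] /ru /= [-> ->].
move=> c d r1' r2' /cdu[-> ->] /ru[<- <-] {c d r1' r2'}.
have [z hz] := primitive_cube_root.
have hz2 := root_sq_root hz.
rewrite (T3_jacobi hp hp3 hg hz) //; congr (_ + _).
rewrite -[9 * _ * _]mulrA.
rewrite delta_norm ?normr_ge0 ?real_normK ?num_real ?(cubic_rep_neq0 hp hp3 E) //.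
rewrite -[RHS]mulrA [RHS]mulrCA; congr (_ * _).
have n2 : 2 != 0 :> algC by rewrite pnatr_eq0.
apply: (mulfI n2); rewrite mulrA mulrV ?unitfE // mul1r mulrDr.
rewrite mulrCA [X in _ + X]mulrCA !jac //.
(* y is not a cube, so its index is 1 or 2 modulo 3 *)
have e0 : (ind g y %% 3)%N != 0%N.
  apply/eqP => e0; apply: hy; exists (FinRing.uval g ^+ (ind g y %/ 3)).
  by rewrite -exprM {1}(indP hp hp3 hg hy0) {1}(divn_eq (ind g y) 3) e0 addn0.
rewrite /chi (negPf hy0) (root_expr_mod3 hz (esym (modn_mod _ _))).
have : (ind g y %% 3 < 3)%N by rewrite ltn_mod.
case: (ind g y %% 3)%N e0 => [|[|[|//]]] // _ _.
  by ring: (root_sqE hz).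
by ring: (root_sqE hz).
Qed.
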